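(* Let $M\subseteq\mathbb{T}$ satisfy the standing hypothesis. The complete core $\mathrm{core}_{\oplus}(\rho^\forall_M)$ of the universal closure for the next-time transformer $\oplus$ exists, and its set of fixpoints is $\{Y\subseteq\mathbb{T}\mid\forall k\in\mathbb{N}.\ \ominus^k(Y)=\rho^\forall_M(\ominus^k(Y))\}$.
   Context: $\mathbb{T}$ is the set of traces $\langle i,\sigma\rangle$, $i\in\mathbb{Z}$, $\sigma:\mathbb{Z}\to\mathbb{S}$; $X_{\downarrow s}=\{\langle i,\sigma\rangle\in X\mid\sigma_i=s\}$; $\oplus(X)=\{\langle i,\sigma\rangle\mid\langle i+1,\sigma\rangle\in X\}$, $\ominus(X)=\{\langle i,\sigma\rangle\mid\langle i-1,\sigma\rangle\in X\}$, $\curvearrowleft(X)=\{\langle -i,\lambda k.\sigma_{-k}\rangle\mid\langle i,\sigma\rangle\in X\}$. Standing hypothesis on $M$: (i) $|M_{\downarrow s}|>1$ for all $s$; (ii) $\oplus(M)=M=\ominus(M)$ and $\oplus(\curvearrowleft M)=\curvearrowleft M=\ominus(\curvearrowleft M)$. $\rho^\forall_M(X)=\{\langle i,\sigma\rangle\in M\mid M_{\downarrow\sigma_i}\subseteq X\}$. Upper closure operators on $\langle\wp(\mathbb{T}),\supseteq\rangle$: maps monotone w.r.t. $\subseteq$, idempotent, with $\rho(X)\subseteq X$; ordered by $\rho\sqsubseteq\eta$ iff $\rho(X)\supseteq\eta(X)$ for all $X$; a closure is identified with its set of fixpoints (its image). $\rho$ is complete for $f$ if $\rho\circ f=\rho\circ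 f\circ\rho$. The complete core of $\rho$ for $f$ is the $\sqsubseteq$-least closure $\eta$ with $\rho\sqsubseteq\eta$ complete for $f$. *)

(* Defs.v *)
From mathcomp Require Import all_boot all_order all_algebra.
From mathcomp Require Import boolp classical_sets.

Set Implicit Arguments.
Unset Strict Implicit.
Unset Printing Implicit Defensive.

Import GRing.Theory.
Local Open Scope ring_scope.
Local Open Scope classical_set_scope.

Definition trace (S : Type) : Type := (int * (int -> S))%type.

Definition current_state (S : Type) (t : trace S) : S := t.2 t.1.

Definition restrict_state (S : Type) (X : set (trace S)) (s : S) :
  set (trace S) := [set t | X t /\ current_state t = s].

Definition oplus (S : Type) (X : set (trace S)) : set (trace S) :=
  [set t | X (t.1 + 1, t.2)].

Definition ominus (S : Type) (X : set (trace S)) : set (trace S) :=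
  [set t | X (t.1 - 1, t.2)].

Definition reverse_trace (S : Type) (t : trace S) : trace S :=
  (- t.1, fun k => t.2 (- k)).

Definition reversal (S : Type) (X : set (trace S)) : set (trace S) :=
  @reverse_trace S @` X.

Definition standing_hypothesis (S : Type) (M : set (trace S)) : Prop :=
  [/\ forall s, exists t u,
        [/\ restrict_state M s t, restrict_state M s u & t <> u],
      oplus M = M /\ ominus M = M
    & oplus (reversal M) = reversal M /\ ominus (reversal M) = reversal M].

Definition rho_forall (S : Type) (M X : set (trace S)) : set (trace S) :=
  [set t | M t /\ restrict_state M (current_state t) `<=` X].

(* The order on the powerset is reverse inclusion, so extensivity of an upper
   closure reads [rho X `<=` X]. *)
Definition is_uco (T : Type) (rho : set T -> set T) : Prop :=
  [/\ forall X Y, X `<=` Y -> rho X `<=` rho Y,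
      forall X, rho (rho X) = rho X
    & forall X, rho X `<=` X].

Definition uco_le (T : Type) (rho eta : set T -> set T) : Prop :=
  forall X, eta X `<=` rho X.

Definition complete_for (T : Type) (f rho : set T -> set T) : Prop :=
  rho \o f = rho \o f \o rho.

Definition is_complete_core (T : Type) (f rho eta : set T -> set T) : Prop :=
  [/\ is_uco eta, uco_le rho eta, complete_for f eta
    & forall eta', is_uco eta' -> uco_le rho eta' -> complete_for f eta' ->
        uco_le eta eta'].

Definition fixpoints (T : Type) (rho : set T -> set T) : set (set T) :=
  [set Y | rho Y = Y].

(* Main.v *)
(** Since [ominus] is left adjoint to [oplus], a closure [eta] is complete for
    [oplus] exactly when its fixpoints are stable under [ominus].  Hence the core
    has as fixpoints the largest [ominus]-stable family of fixpoints of
    [rho_forall M].  This family is closed under unions, so it is the image of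
    the closure sending [X] to the union of its members included in [X]. *)

Require Import Defs.
From mathcomp Require Import all_boot all_order all_algebra.
From mathcomp Require Import boolp classical_sets.

Local Open Scope classical_set_scope.

Definition stable_fixpoints {T : Type} (g rho : set T -> set T) : set (set T) :=
  [set Y | forall k : nat, iter k g Y = rho (iter k g Y)].

Definition stable_core {T : Type} (g rho : set T -> set T) (X : set T) : set T :=
  [set t | exists Y, [/\ stable_fixpoints g rho Y, Y `<=` X & Y t]].

(** Transfers the fixpoint description from the constructed core to an arbitrary one. *)
Lemma is_complete_core_unique {T : Type} (f rho c c' : set T -> set T) :
  is_complete_core f rho c -> is_complete_core f rho c' -> c = c'.
Proof.
move=> [uc lc cc minc] [uc' lc' cc' minc'].
by apply/funext => X; apply/seteqP; split; [exact: minc'|exact: minc].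
Qed.

Section AdjointCore.
Context {T : Type} {f g rho : set T -> set T}.
Hypothesis gf_adj : forall X Y, g X `<=` Y <-> X `<=` f Y.
Hypothesis rho_uco : is_uco rho.

Local Notation F := (stable_fixpoints g rho).
Local Notation core := (stable_core g rho).

Lemma iter_adjoint k X Y : iter k g X `<=` Y <-> X `<=` iter k f Y.
Proof.
elim: k X Y => [//|k IH] X Y; rewrite iterS iterSr.
exact: (iff_trans (gf_adj _ _) (IH _ _)).
Qed.

(** Monotonicity comes from the unit of the adjunction: [Y] lies in [f^k (g^k Y)]. *)
Lemma iter_adjoint_homo k X Y : X `<=` Y -> iter k g X `<=` iter k g Y.
Proof.
by move=> XY; apply/iter_adjoint; apply: subset_trans XY _; apply/iter_adjoint.
Qed.

Lemma stable_fixpoints_step Y : F Y -> F (g Y).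
Proof. by move=> FY k; rewrite -iterSr. Qed.

Lemma stable_core_sub X : core X `<=` X.
Proof. by move=> t [Y [_ YX Yt]]; exact: YX. Qed.

Lemma stable_core_max X Y : F Y -> Y `<=` X -> Y `<=` core X.
Proof. by move=> FY YX t Yt; exists Y. Qed.

Lemma stable_core_homo X Y : X `<=` Y -> core X `<=` core Y.
Proof.
by move=> XY t [Z [FZ ZX Zt]]; exists Z; split=> //; exact: subset_trans XY.
Qed.

(** As a left adjoint, [g^k] preserves unions, so [g^k (core X)] is the union of the sets
    [g^k Y = rho (g^k Y)] over stable [Y] inside [X], each contained in [rho (g^k (core X))]. *)
Lemma stable_core_stable X : F (core X).
Proof.
case: rho_uco => rho_homo _ rho_sub k.
apply/seteqP; split; last exact: rho_sub.
(* Transposing leaves [core X] alone on the left, so a point yields its witness [Y]; the inclusion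
   is then proved for all of [Y] and transposed back. *)
apply/iter_adjoint => t [Y [FY YX Yt]]; move: t Yt.
change (Y `<=` iter k f (rho (iter k g (core X)))).
apply/iter_adjoint; rewrite (FY k); apply: rho_homo.
by apply: iter_adjoint_homo; exact: stable_core_max.
Qed.

Lemma stable_core_fixpoints : fixpoints core = F.
Proof.
apply/seteqP; split=> [Y <-|Y FY]; first exact: stable_core_stable.
by apply/seteqP; split; [exact: stable_core_sub|exact: stable_core_max].
Qed.

Lemma stable_core_uco : is_uco core.
Proof.
split; [exact: stable_core_homo| |exact: stable_core_sub] => X.
have : F (core X) by exact: stable_core_stable.
by rewrite -stable_core_fixpoints.
Qed.

(** If [Y] is stable and inside [f X], then [g Y] is stable and inside [X], hence inside [core X];
    transposing puts [Y] inside [f (core X)]. *)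
Lemma stable_core_complete : complete_for f core.
Proof.
apply/funext => X /=; apply/seteqP; split=> [t [Y [FY YX Yt]]|].
  exists Y; split=> //; apply/gf_adj; apply: stable_core_max.
    exact: stable_fixpoints_step.
  exact/gf_adj.
apply: stable_core_homo; apply/gf_adj.
by apply: subset_trans (@stable_core_sub X); apply/gf_adj.
Qed.

(** Transpose the chain [Y = eta Y ⊆ eta (f (g Y)) = eta (f (eta (g Y))) ⊆ f (eta (g Y))], given by
    the unit and completeness. *)
Lemma complete_fixpoint_step (eta : set T -> set T) Y :
  is_uco eta -> complete_for f eta -> eta Y = Y -> eta (g Y) = g Y.
Proof.
move=> [eta_homo _ eta_sub] ceta etaY.
apply/seteqP; split; first exact: eta_sub.
apply/gf_adj; rewrite -{1}etaY.
apply: (@subset_trans _ (eta (f (g Y)))); first by apply: eta_homo; apply/gf_adj.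
move: (congr1 (fun h => h (g Y)) ceta) => /= ->; exact: eta_sub.
Qed.

(** Each [g^k (eta X)] is fixed by [eta], hence by [rho], so [eta X] is itself one of the stable
    sets whose union is [core X]. *)
Lemma stable_core_least (eta : set T -> set T) :
  is_uco eta -> uco_le rho eta -> complete_for f eta -> uco_le core eta.
Proof.
move=> ueta le_eta ceta X.
have [_ eta_idem eta_sub] := ueta; have [_ _ rho_sub] := rho_uco.
apply: stable_core_max; last exact: eta_sub.
have fix_iter k : eta (iter k g (eta X)) = iter k g (eta X).
  by elim: k => [|k IH]; [exact: eta_idem|exact: complete_fixpoint_step].
move=> k; apply/seteqP; split; last exact: rho_sub.
rewrite -{1}fix_iter; exact: le_eta.
Qed.

Theorem stable_core_is_complete_core : is_complete_core f rho core.
Proof.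
have [rho_homo _ _] := rho_uco.
split; [exact: stable_core_uco| |exact: stable_core_complete
       |exact: stable_core_least].
(* Stability at [k = 0] makes [core X] a fixpoint of [rho]. *)
move=> X; have /= -> := stable_core_stable X 0.
by apply: rho_homo; exact: stable_core_sub.
Qed.

End AdjointCore.

Lemma ominus_oplus_adjoint (S : Type) (X Y : set (trace S)) :
  ominus X `<=` Y <-> X `<=` oplus Y.
Proof.
rewrite /ominus /oplus; split=> XY [i s] Xt.
  by apply: XY; rewrite /= GRing.addrK.
by have := XY _ Xt; rewrite /= GRing.subrK.
Qed.

Lemma rho_forall_uco (S : Type) (M : set (trace S)) : is_uco (rho_forall M).
Proof.
have sub X : rho_forall M X `<=` X by move=> t [Mt]; exact.
split=> // [X Y XY t [Mt MX]|X]; first by split=> // u /MX /XY.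
apply/seteqP; split=> [|t [Mt MX]]; first exact: sub.
(* Traces of [M] sharing a current state face the same test, so they pass together. *)
by split=> // u [Mu eu]; split=> //; rewrite eu.
Qed.

Theorem theorem6 (S : Type) (M : set (trace S)) (hM : standing_hypothesis M) :
  (exists core : set (trace S) -> set (trace S),
     is_complete_core (@oplus S) (rho_forall M) core) /\
  (forall core : set (trace S) -> set (trace S),
     is_complete_core (@oplus S) (rho_forall M) core ->
     fixpoints core =
     [set Y | forall k : nat,
        iter k (@ominus S) Y = rho_forall M (iter k (@ominus S) Y)]).
Proof.
have coreP := stable_core_is_complete_core (@ominus_oplus_adjoint S)
                (rho_forall_uco S M).
split=> [|c /is_complete_core_unique/(_ coreP) ->]; first by eexists; exact: coreP.
exact: stable_core_fixpoints (@ominus_oplus_adjoint S) (rho_forall_uco S M).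
Qed.
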